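(* Let $(X,d)$ be a non-compact metric space and let $f:X\to\mathbb{R}$ be bounded and continuous. Let $p:X\times\mathbb{R}\to\mathbb{R}$ be a convex extension of $f$, and let $g(t)=\sup_{x\in X}p(x,t)$ for $t\in\mathbb{R}$. Suppose there exist maximizing sequences $\{x_n\}$ and $\{y_n\}$ of $f$, a $\delta>0$, a sequence of positive reals $t_n\to 0$ and a sequence of negative reals $s_n\to 0$ such that the functions $t\mapsto p(x_n,t)$ and $t\mapsto p(y_n,t)$ both converge pointwise to $g$ on $(-\delta,\delta)$ as $n\to\infty$, $\limsup_{n\to\infty}p_{t+}(x_n,t_n)\ge 0$, and $\liminf_{n\to\infty}p_{t-}(y_n,s_n)\le 0$. Then $p$ is a Birkhoff-James extension of $f$.
   Context: Let $(X,d)$ be a non-compact metric space and $f:X\to\mathbb{R}$ a bounded continuous function. Convex extension (non-compact case): a continuous map $p:X\times\mathbb{R}\to\mathbb{R}$ is a convex extension of $f$ if (i) for each $t\in\mathbb{R}$, $x\mapsto p(x,t)$ is a bounded function on $X$; (ii) for each $x\in X$, $p(x,0)=f(x)$ and $t\mapsto p(x,t)$ is a convex function on $\mathbb{R}$; (iii) there exists a continuous map $h:\mathbb{R}\to\mathbb{R}$ such that $h(0)=0$ and $|p(x,t)-p(x,s)|\le|h(t)-h(s)|$ for all $x\in X$ and $t,s\in\mathbb{R}$. Birkhoff-James extension: a convex extension $p$ of $f$ is a Birkhoff-James extension of $f$ if $g(t)\ge g(0)$ for all $t\in\mathbb{R}$, where $g(t)=\sup_{x\in X}p(x,t)$. Maximizing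 sequence: a sequence $\{x_n\}$ in $X$ is a maximizing sequence for $f$ if $f(x_n)\to\sup_{x\in X}f(x)$. Notation: $p_{t+}(x_0,t_0)$ and $p_{t-}(x_0,t_0)$ denote the right and left derivatives at $t_0$ of $t\mapsto p(x_0,t)$. *)

(* Defs.v *)
From HB Require Import structures.
From mathcomp Require Import all_boot all_order all_algebra.
From mathcomp Require Import all_classical all_reals all_analysis.
Set Implicit Arguments.
Unset Strict Implicit.
Unset Printing Implicit Defensive.
Import Order.TTheory GRing.Theory Num.Theory numFieldNormedType.Exports.
Local Open Scope classical_set_scope.
Local Open Scope ring_scope.

(* For convex [phi : R -> R] the one-sided limits below always exist. *)
Definition right_derivative (R : realType) (phi : R -> R) (t : R) : R :=
  lim (h^-1 * (phi (t + h) - phi t) @[h --> 0^'+]).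

Definition left_derivative (R : realType) (phi : R -> R) (t : R) : R :=
  lim (h^-1 * (phi (t + h) - phi t) @[h --> 0^'-]).

Record convex_extension (R : realType) (X : metricType R)
    (f : X -> R) (p : X * R -> R) : Prop := ConvexExtension {
  convex_extension_continuous : continuous p ;
  convex_extension_bounded : forall t : R, bounded_fun (fun x : X => p (x, t)) ;
  convex_extension_at0 : forall x : X, p (x, 0) = f x ;
  convex_extension_convex : forall x : X,
    convex_function (E := R^o) setT (fun t : R => p (x, t)) ;
  convex_extension_modulus : exists h : R -> R,
    [/\ continuous h, h 0 = 0 &
        forall (x : X) (t s : R), `|p (x, t) - p (x, s)| <= `|h t - h s|] }.

(* The real supremum is meaningful when [X] is nonempty and each [p (-, t)] is
   bounded above; both hold for convex extensions on non-compact spaces. *)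
Definition sup_slice (R : realType) (X : metricType R) (p : X * R -> R)
    (t : R) : R :=
  sup (range (fun x : X => p (x, t))).

Definition BJ_extension (R : realType) (X : metricType R)
    (f : X -> R) (p : X * R -> R) : Prop :=
  convex_extension f p /\ forall t : R, sup_slice p 0 <= sup_slice p t.

Definition maximizing_sequence (R : realType) (X : metricType R)
    (f : X -> R) (x : nat -> X) : Prop :=
  f (x n) @[n --> \oo] --> sup (range f).

(* Main.v *)
(** Fix [u > 0].  Convexity gives, as soon as [t n < u],
      right derivative of [p (x n, -)] at [t n]
        <= (p (x n, u) - p (x n, t n)) / (u - t n)
        <= (g u - p (x n, t n)) / (u - t n),
    and the common modulus [h] forces [p (x n, t n)] to tend to [g 0], so the
    last quotient tends to [(g u - g 0) / u].  A nonnegative limsup on the left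
    therefore gives [g 0 <= g u] for every [u > 0] at once; negative [u] follow
    by reflecting [t] to [- t]. *)
Require Import Defs.
From HB Require Import structures.
From mathcomp Require Import all_boot all_order all_algebra.
From mathcomp Require Import all_classical all_reals all_analysis.
From mathcomp Require Import ring lra.
Set Implicit Arguments.
Unset Strict Implicit.
Unset Printing Implicit Defensive.
Import Order.TTheory GRing.Theory Num.Theory numFieldNormedType.Exports.
Local Open Scope classical_set_scope.
Local Open Scope ring_scope.

(** Here [b] is the convex combination of [a] and [c] with weight [(c - b) / (c - a)] on [a].
    Clearing denominators makes later slope comparisons linear in the values of [phi]. *)
Lemma convex_function_chord (R : realType) (phi : R -> R) (a b c : R) :
  convex_function (E := R^o) setT phi -> a < b -> b < c ->
  phi b * (c - a) <= phi a * (c - b) + phi c * (b - a).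
Proof.
move=> cphi ab bc.
have ca0 : 0 < c - a by lra.
have k0 : 0 <= (c - b) / (c - a) by rewrite divr_ge0//; lra.
have k1 : (c - b) / (c - a) <= 1 by rewrite ler_pdivrMr//; lra.
set k := (c - b) / (c - a) in k0 k1.
have kE : k * (c - a) = c - b by rewrite /k divfK// gt_eqF.
have kb : k * a + (1 - k) * c = b.
  have -> : k * a + (1 - k) * c = c - k * (c - a) by ring.
  by rewrite kE subKr.
have : phi (k * a + (1 - k) * c) <= k * phi a + (1 - k) * phi c.
  exact: (cphi (Itv01 k0 k1) a c (mem_set I) (mem_set I)).
rewrite kb.
move=> /(ler_wpM2r (ltW ca0)) /le_trans; apply.
have -> : b - a = c - a - (c - b) by ring.
by rewrite -kE le_eqVlt; apply/orP; left; apply/eqP; ring.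
Qed.

(** The quotient is nondecreasing in [h > 0] and bounded below, so it converges as [h] decreases to
    0. *)
Lemma convex_function_right_quotient_is_cvg (R : realType) (phi : R -> R) (t : R) :
  convex_function (E := R^o) setT phi ->
  cvg (h^-1 * (phi (t + h) - phi t) @[h --> 0^'+]).
Proof.
move=> cphi.
apply: nondecreasing_at_right_is_cvgr.
  near=> e => h k; rewrite !in_itv/= => /andP[h0 _] /andP[k0 _].
  rewrite le_eqVlt => /predU1P[->//|hk].
  have := @convex_function_chord R phi t (t + h) (t + k) cphi.
  rewrite ltrDl h0 ltrD2l hk => /(_ isT isT) H.
  rewrite ler_pdivrMl// mulrCA ler_pdivlMl//; lra.
(* The lower bound is the slope of the chord over [[t - 1, t]]. *)
near=> e; exists (phi t - phi (t - 1)) => _ [h /= + <-].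
rewrite in_itv/= => /andP[h0 _].
rewrite ler_pdivlMl//.
have := @convex_function_chord R phi (t - 1) t (t + h) cphi.
have -> : t - 1 < t by lra.
have -> : t < t + h by lra.
move=> /(_ isT isT); lra.
Unshelve. all: end_near. Qed.

Lemma right_derivative_le (R : realType) (phi : R -> R) (t u : R) :
  convex_function (E := R^o) setT phi -> t < u ->
  right_derivative phi t <= (phi u - phi t) / (u - t).
Proof.
move=> cphi tu; apply: limr_le.
  exact: convex_function_right_quotient_is_cvg.
near=> h.
have h0 : 0 < h by near: h; exact: nbhs_right_gt.
have hu : t + h < u.
  by rewrite -ltrBrDl; near: h; apply: nbhs_right_lt; rewrite subr_gt0.
rewrite ler_pdivrMl// mulrA ler_pdivlMr ?subr_gt0//.
have := @convex_function_chord R phi t (t + h) u cphi _ hu.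
rewrite ltrDl => /(_ h0); lra.
Unshelve. all: end_near. Qed.

Lemma convex_function_opp (R : realType) (phi : R -> R) :
  convex_function (E := R^o) setT phi ->
  convex_function (E := R^o) setT (fun u => phi (- u)).
Proof.
move=> cphi k a b _ _.
have : phi (k%:num * - a + (1 - k%:num) * - b) <=
    k%:num * phi (- a) + (1 - k%:num) * phi (- b).
  exact: (cphi k (- a) (- b) (mem_set I) (mem_set I)).
by rewrite !mulrN -opprD.
Qed.

Lemma left_derivative_opp (R : realType) (phi : R -> R) (t : R) :
  convex_function (E := R^o) setT phi ->
  left_derivative phi t = - right_derivative (fun u => phi (- u)) (- t).
Proof.
move=> cphi; have cvgq := @convex_function_right_quotient_is_cvg _ _ (- t)
   (convex_function_opp cphi).
rewrite /left_derivative /right_derivative -(limN cvgq).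
have qE : (fun h => h^-1 * (phi (t + h) - phi t)) \o -%R =
    - (fun h => h^-1 * (phi (- (- t + h)) - phi (- - t))).
  apply/funext => h; change ((- h)^-1 * (phi (t - h) - phi t) =
    - (h^-1 * (phi (- (- t + h)) - phi (- - t)))).
  by rewrite invrN mulNr opprD !opprK.
(* The left filter at [0 = - 0] is the image of the right filter at 0 under negation. *)
by rewrite -[in LHS]oppr0 at_leftN -fmap_comp qE.
Qed.

Lemma limn_esup_le_lim (R : realType) (a b : nat -> R) (l : R) :
  (\forall n \near \oo, a n <= b n) -> b n @[n --> \oo] --> l ->
  (limn_esup (fun n => (a n)%:E) <= l%:E)%E.
Proof.
move=> ab bl; apply/lee_addgt0Pr => e e0.
(* The limsup is an infimum of suprema over sets in the filter [\oo]; this set is one of them, since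
   eventually [a n <= b n < l + e]. *)
apply: (@le_trans _ _ (ereal_sup ((fun n => (a n)%:E) @` [set n | a n <= l + e]))).
  apply: ereal_inf_lbound; exists [set n | a n <= l + e] => //.
  have ble : \forall n \near \oo, b n < l + e.
    by move: bl => /cvgr_lt; apply; rewrite ltrDl.
  by apply: filterS2 ab ble => n anbn bnl; rewrite /= (le_trans anbn)// ltW.
by apply: ge_ereal_sup => _ [n /= anl <-]; rewrite lee_fin.
Qed.

(** Stated for an arbitrary sequence of convex functions, so as to cover both [p (x n, v)] and the
    reflected [p (y n, - v)]. *)
Lemma limn_esup_right_derivative_ge0_le (R : realType) (phi : nat -> R -> R)
    (t : nat -> R) (a b u : R) :
  (forall n, convex_function (E := R^o) setT (phi n)) ->
  0 < u -> t n @[n --> \oo] --> (0 : R) ->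
  phi n (t n) @[n --> \oo] --> a -> (forall n, phi n u <= b) ->
  (0 <= limn_esup (fun n => (right_derivative (phi n) (t n))%:E))%E ->
  a <= b.
Proof.
move=> cphi u0 t0 phia phib lim0.
(* The denominator stays [u - 0] to match the limit of [u - t n]. *)
suff : (0%:E <= ((b - a) / (u - 0))%:E)%E.
  by rewrite lee_fin subr0 pmulr_lge0 ?invr_gt0// subr_ge0.
apply: (le_trans lim0).
apply: (limn_esup_le_lim (b := fun n => (b - phi n (t n)) / (u - t n))).
  have tu : \forall n \near \oo, t n < u by move: t0 => /cvgr_lt; apply.
  apply: filterS tu => n tu.
  apply: (le_trans (right_derivative_le (cphi n) tu)).
  by rewrite ler_pM2r ?invr_gt0 ?subr_gt0// lerB.
apply: cvgM; first by apply: cvgB phia; exact: cvg_cst.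
apply: cvgV; first by rewrite subr0 gt_eqF.
by apply: cvgB t0; exact: cvg_cst.
Qed.

(** The modulus is uniform in the point of [X]: the gap between [p (x n, t n)] and [f (x n)] is at
    most [|h (t n)|], however [x n] moves. *)
Lemma convex_extension_cvg_diag (R : realType) (X : metricType R)
    (f : X -> R) (p : X * R -> R) (x : nat -> X) (t : nat -> R) (l : R) :
  convex_extension f p -> t n @[n --> \oo] --> (0 : R) ->
  f (x n) @[n --> \oo] --> l -> p (x n, t n) @[n --> \oo] --> l.
Proof.
move=> pf t0 fl; have [h [hc h0 hp]] := convex_extension_modulus pf.
have ht : h (t n) @[n --> \oo] --> (0 : R).
  by rewrite -h0; apply: continuous_cvg => //; exact: hc.
suff pft : p (x n, t n) - f (x n) @[n --> \oo] --> (0 : R).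
  rewrite -[l]add0r.
  rewrite (_ : (fun n => p (x n, t n)) =
    (fun n => p (x n, t n) - f (x n)) + (f \o x)); first exact: cvgD.
  by apply/funext => n; rewrite [RHS]subrK.
apply/norm_cvg0P; apply: (@squeeze_cvgr _ _ _ _ (fun=> 0) (fun n => `|h (t n)|)).
- by near=> n; rewrite normr_ge0/= -(convex_extension_at0 pf) (le_trans (hp _ _ _))// h0 subr0.
- exact: cvg_cst.
- by apply/norm_cvg0P.
Unshelve. all: end_near. Qed.

Lemma le_sup_slice (R : realType) (X : metricType R)
    (f : X -> R) (p : X * R -> R) (x : X) (t : R) :
  convex_extension f p -> p (x, t) <= sup_slice p t.
Proof.
move=> pf; apply: ub_le_sup; last by exists x.
exact/bounded_fun_has_ubound/(convex_extension_bounded pf).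
Qed.

Theorem theorem3p6 (R : realType) (X : metricType R)
  (X_noncompact : ~ compact [set: X])
  (f : X -> R) (f_bounded : bounded_fun f) (f_continuous : continuous f)
  (p : X * R -> R) (p_ext : convex_extension f p)
  (hyp : exists (x y : nat -> X) (delta : R) (t s : nat -> R),
    maximizing_sequence f x /\
    maximizing_sequence f y /\
    0 < delta /\
    (forall n : nat, 0 < t n) /\ t n @[n --> \oo] --> (0 : R) /\
    (forall n : nat, s n < 0) /\ s n @[n --> \oo] --> (0 : R) /\
    (forall u : R, - delta < u < delta ->
       p (x n, u) @[n --> \oo] --> sup_slice p u) /\
    (forall u : R, - delta < u < delta ->
       p (y n, u) @[n --> \oo] --> sup_slice p u) /\
    (0 <= limn_esup (fun n : nat =>
       (right_derivative (fun u : R => p (x n, u)) (t n))%:E))%E /\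
    (limn_einf (fun n : nat =>
       (left_derivative (fun u : R => p (y n, u)) (s n))%:E) <= 0)%E) :
  BJ_extension f p.
Proof.
split=> // u.
have [x [y [_ [t [s [fx [fy [_ [_ [t0 [_ [s0 [_ [_ [rx ly]]]]]]]]]]]]]]] := hyp.
have cp x0 := convex_extension_convex p_ext x0.
have g0 : sup_slice p 0 = sup (range f).
  rewrite /sup_slice (_ : (fun z => p (z, 0)) = f)//; apply/funext => z.
  exact: convex_extension_at0 p_ext z.
have [u0|u0|->//] := ltgtP 0 u.
  apply: (limn_esup_right_derivative_ge0_le (phi := fun n v => p (x n, v)) _ u0 t0 _ _ rx) => //.
    by rewrite g0; exact: convex_extension_cvg_diag p_ext t0 fx.
  by move=> n; exact: le_sup_slice p_ext.
(* For [u < 0], the positive case is applied to [p (y n, - v)] at the points [- s n] and [- u]. *)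
have s0N : - s n @[n --> \oo] --> (0 : R) by rewrite -oppr0; exact: cvgN.
apply: (limn_esup_right_derivative_ge0_le (phi := fun n v => p (y n, - v)) (u := - u) _ _ s0N).
- by move=> n; exact: (convex_function_opp (cp (y n))).
- by rewrite oppr_gt0.
- under eq_fun do rewrite opprK.
  by rewrite g0; exact: convex_extension_cvg_diag p_ext s0 fy.
- by move=> n; rewrite opprK; exact: le_sup_slice p_ext.
(* The liminf is minus the limsup of the negated sequence; this sign cancels the one from reflecting
   the left derivative. *)
- move: ly; rewrite /limn_einf oppe_le0; congr (_ <= limn_esup _)%E.
  by apply/funext => n /=; rewrite left_derivative_opp// opprK.
Qed.
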